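(* Let $p,q>0$ be real numbers. The map $\mu$ on $\mathbb{R}^+\times\mathbb{R}^+$ preserves the symplectic form $\omega=d\log(x)\wedge d\log(y)=\frac{1}{xy}\,dx\wedge dy$, i.e. $\mu^*\omega=\omega$. Equivalently, $\mu$ is a Poisson map for the Poisson bracket on $\mathbb{R}^+\times\mathbb{R}^+$ defined by $\{x,y\}=xy$.
   Context: $\mathbb{R}^+$ denotes the positive real numbers. For positive reals $p,q$, the maps $\mu_1,\mu_2$ on $\mathbb{R}^+\times\mathbb{R}^+$ are $\mu_1(x,y)=\left(\frac{1+y^q}{x},\,y\right)$ and $\mu_2(x,y)=\left(x,\,\frac{1+x^p}{y}\right)$, and $\mu=\mu_2\circ\mu_1$. *)

(* Defs.v *)
From HB Require Import structures.
From mathcomp Require Import all_boot all_order all_algebra.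
From mathcomp Require Import all_classical all_reals all_analysis.

Set Implicit Arguments.
Unset Strict Implicit.
Unset Printing Implicit Defensive.

Import Order.TTheory GRing.Theory Num.Theory.
Import numFieldNormedType.Exports.

Local Open Scope classical_set_scope.
Local Open Scope ring_scope.

(* The manifold R^+ x R^+ is the open subset [quadrant] of the plane; functions,
   maps and forms are total on the plane, and only their values on [quadrant]
   are ever constrained. *)
Definition quadrant (R : realType) : set (R * R) :=
  [set z | 0 < z.1 /\ 0 < z.2].
Arguments quadrant {R}.

Definition mu1 (R : realType) (q : R) (z : R * R) : R * R :=
  ((1 + z.2 `^ q) / z.1, z.2).

Definition mu2 (R : realType) (p : R) (z : R * R) : R * R :=
  (z.1, (1 + z.1 `^ p) / z.2).

Definition mu (R : realType) (p q : R) : R * R -> R * R := mu2 p \o mu1 q.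

Fixpoint Ck_on_quadrant (R : realType) (W : normedModType R) (k : nat)
    (f : R * R -> W) : Prop :=
  match k with
  | 0 => forall z, quadrant z -> {for z, continuous f}
  | k'.+1 => (forall z, quadrant z -> differentiable f z) /\
             (forall v : R * R, Ck_on_quadrant k' ('D_v f))
  end.

Definition smooth_on_quadrant (R : realType) (W : normedModType R)
    (f : R * R -> W) : Prop := forall k, Ck_on_quadrant k f.

Definition smooth_self_map (R : realType) (phi : R * R -> R * R) : Prop :=
  (forall z, quadrant z -> quadrant (phi z)) /\ smooth_on_quadrant phi.

(* [a z u] is the value at the point z of the form a on the tangent vector u,
   and similarly for 2-forms. *)
Definition form1 (R : realType) := R * R -> R * R -> R.
Definition form2 (R : realType) := R * R -> R * R -> R * R -> R.

Definition ext_d (R : realType) (f : R * R -> R) : form1 R :=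
  fun z u => 'd f z u.

Definition wedge (R : realType) (a b : form1 R) : form2 R :=
  fun z u v => a z u * b z v - a z v * b z u.

Definition pullback (R : realType) (phi : R * R -> R * R) (w : form2 R) :
    form2 R :=
  fun z u v => w (phi z) ('d phi z u) ('d phi z v).

Definition omega (R : realType) : form2 R :=
  wedge (ext_d (fun z => ln z.1)) (ext_d (fun z => ln z.2)).

Definition preserves_form (R : realType) (phi : R * R -> R * R)
    (w : form2 R) : Prop :=
  smooth_self_map phi /\
  forall z, quadrant z -> forall u v, pullback phi w z u v = w z u v.

(* The biderivation of the smooth functions on [quadrant] determined by
   {x, y} = xy, that is {F, G} = xy (F_x G_y - F_y G_x). *)
Definition bracket (R : realType) (F G : R * R -> R) : R * R -> R :=
  fun z => z.1 * z.2 *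
    ('D_(1, 0) F z * 'D_(0, 1) G z - 'D_(0, 1) F z * 'D_(1, 0) G z).

Definition poisson_map (R : realType) (phi : R * R -> R * R) : Prop :=
  smooth_self_map phi /\
  forall F G : R * R -> R, smooth_on_quadrant F -> smooth_on_quadrant G ->
  forall z, quadrant z ->
    bracket (F \o phi) (G \o phi) z = bracket F G (phi z).

Lemma bracket_coordinates (R : realType) (z : R * R) :
  bracket fst snd z = z.1 * z.2.
Proof.
have c1 : continuous (fst : R * R -> R) by move=> w; exact: cvg_fst.
have c2 : continuous (snd : R * R -> R) by move=> w; exact: cvg_snd.
have D1 (v : R * R) : 'D_v (fst : R * R -> R) z = v.1.
  by rewrite deriveE ?diff_lin //; exact: linear_differentiable.
have D2 (v : R * R) : 'D_v (snd : R * R -> R) z = v.2.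
  by rewrite deriveE ?diff_lin //; exact: linear_differentiable.
by rewrite /bracket !D1 !D2 /= mulr0 subr0 !mulr1.
Qed.

(* Main.v *)
(* In the coordinates (log x, log y) the form omega is the area form.  Each of
   mu1 and mu2 fixes one coordinate and replaces the other one, w, by (a function
   of the fixed one) / w, which reverses the sign of the logarithmic area; hence
   mu preserves it.  Brackets of pulled back functions scale by the same Jacobian
   factor.  For smoothness, the functions obtained from the coordinates by sums,
   products and real powers of positive functions have derivatives of the same
   kind. *)

Require Import Defs.
From HB Require Import structures.
From mathcomp Require Import all_boot all_order all_algebra.
From mathcomp Require Import all_classical all_reals all_analysis.
From mathcomp Require Import ring.

Set Implicit Arguments.
Unset Strict Implicit.
Unset Printing Implicit Defensive.

Import Order.TTheory GRing.Theory Num.Theory.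
Import numFieldNormedType.Exports.

Local Open Scope classical_set_scope.
Local Open Scope ring_scope.

(** A first-order expansion at [x] only sees the germ at [x], so the expansion of [f] is one for
    [g]. Uniqueness of the differential then identifies ['d g x] with ['d f x]. *)
Lemma near_eq_differentiable (R : numFieldType) (V W : normedModType R)
    (f g : V -> W) (x : V) :
  {near x, f =1 g} -> differentiable f x -> differentiable g x.
Proof.
move=> fg df.
have gE : g \o shift x = cst (g x) + 'd f x +o_ 0 id.
  apply/eqaddoP => e e0.
  have /eqaddoP/(_ e e0) := diff_locally df.
  have : {near 0, f \o shift x =1 g \o shift x}.
    rewrite (near_shift x 0) /=; apply: filterS fg => y fgy /=.
    by rewrite sub0r subrK.
  apply: filterS2 => y /= fgy; rewrite !fctE /= in fgy *.
  by rewrite fgy (nbhs_singleton fg).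
apply/diff_locallyP.
have -> : 'd g x = 'd f x :> (V -> W).
  by apply: diff_unique => //; exact: diff_continuous.
by split => //; exact: diff_continuous.
Qed.

Section quadrant_calculus.
Variable R : realType.
Implicit Types (p q : R) (z u v : R * R).

(** * Openness of the quadrant and closure properties of its C^k functions *)

Lemma continuous_fst : continuous (fst : R * R -> R).
Proof. by move=> z; exact: cvg_fst. Qed.

Lemma continuous_snd : continuous (snd : R * R -> R).
Proof. by move=> z; exact: cvg_snd. Qed.

Lemma near_quadrant z : quadrant z -> \near z, quadrant z.
Proof.
move=> [z1 z2].
apply: filterS2 (cvgr_gt _ (@continuous_fst z) 0 z1)
                (cvgr_gt _ (@continuous_snd z) 0 z2).
by move=> w w1 w2; split.
Qed.

Lemma near_quadrant_eq (W : Type) (f g : R * R -> W) z :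
  {in @quadrant R, f =1 g} -> quadrant z -> {near z, f =1 g}.
Proof.
by move=> fg /near_quadrant; apply: filterS => w qw; apply: fg; rewrite inE.
Qed.

(** The quadrant is open, so equality on it passes to directional derivatives there and the
    induction goes through. Derivative formulas valid only on the quadrant can thus be fed into the
    recursion defining [Ck_on_quadrant]. *)
Lemma Ck_eq (W : normedModType R) k (f g : R * R -> W) :
  {in @quadrant R, f =1 g} -> Ck_on_quadrant k f -> Ck_on_quadrant k g.
Proof.
elim: k f g => [|k IHk] f g fg /=.
  move=> cf z qz; have fgz := near_quadrant_eq fg qz.
  rewrite /prop_for /continuous_at -(nbhs_singleton fgz).
  apply: cvg_trans (cf z qz); apply: near_eq_cvg.
  by apply: filterS fgz => w ->.
move=> [df Df]; split=> [z qz|v].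
  exact: near_eq_differentiable (near_quadrant_eq fg qz) (df z qz).
apply: IHk (Df v) => z /set_mem qz.
exact: near_eq_derive (near_quadrant_eq fg qz).
Qed.

Lemma Ck_pred (W : normedModType R) k (f : R * R -> W) :
  Ck_on_quadrant k.+1 f -> Ck_on_quadrant k f.
Proof.
elim: k f => [|k IHk] f /= [df Df].
  by move=> z qz; exact/differentiable_continuous/df.
by split => // v; exact/IHk/Df.
Qed.

Lemma Ck_cst (W : normedModType R) k (a : W) :
  Ck_on_quadrant k (cst a : R * R -> W).
Proof.
elim: k a => [|k IHk] a /=; first by move=> z _; exact: cst_continuous.
split=> [//|v]; apply: Ck_eq (IHk 0) => z _.
by rewrite derive_cst.
Qed.

Lemma Ck_linear (W : normedModType R) k (f : {linear (R * R)%type -> W}) :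
  continuous f -> Ck_on_quadrant k f.
Proof.
move=> cf; case: k => [|k] /=; first by move=> z _; exact: cf.
split=> [z _|v]; first exact: linear_differentiable.
apply: Ck_eq (Ck_cst k (f v)) => z _.
by rewrite deriveE ?diff_lin //; exact: linear_differentiable.
Qed.

Lemma CkD (W : normedModType R) k (f g : R * R -> W) :
  Ck_on_quadrant k f -> Ck_on_quadrant k g ->
  Ck_on_quadrant k (fun z => f z + g z).
Proof.
elim: k f g => [|k IHk] f g /=.
  by move=> cf cg z qz; exact: continuousD (cf z qz) (cg z qz).
move=> [df Df] [dg Dg]; split=> [z qz|v].
  exact: differentiableD (df z qz) (dg z qz).
apply: Ck_eq (IHk _ _ (Df v) (Dg v)) => z /set_mem qz.
by rewrite -[RHS]/('D_v (f + g) z) deriveD //; apply: diff_derivable;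
  [exact: df | exact: dg].
Qed.

(** Leibniz rule. It keeps an undifferentiated factor in each term, which [Ck_pred] brings down to
    order [k]. *)
Lemma CkM k (f g : R * R -> R) :
  Ck_on_quadrant k f -> Ck_on_quadrant k g ->
  Ck_on_quadrant k (fun z => f z * g z).
Proof.
elim: k f g => [|k IHk] f g.
  by move=> cf cg z qz; exact: continuousM (cf z qz) (cg z qz).
move=> Cf Cg; have [df Df] := Cf; have [dg Dg] := Cg; split=> [z qz|v].
  exact: differentiableM (df z qz) (dg z qz).
have := CkD (IHk _ _ (Ck_pred Cf) (Dg v)) (IHk _ _ (Ck_pred Cg) (Df v)).
apply: Ck_eq => z /set_mem qz.
by rewrite -[RHS]/('D_v (f * g) z) deriveM //; apply: diff_derivable;
  [exact: df | exact: dg].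
Qed.

Lemma Ck_pair (W1 W2 : normedModType R) k (f : R * R -> W1) (g : R * R -> W2) :
  Ck_on_quadrant k f -> Ck_on_quadrant k g ->
  Ck_on_quadrant k (fun z => (f z, g z)).
Proof.
elim: k f g => [|k IHk] f g /=.
  by move=> cf cg z qz; exact: cvg_pair (cf z qz) (cg z qz).
move=> [df Df] [dg Dg]; split=> [z qz|v].
  exact: differentiable_pair (df z qz) (dg z qz).
apply: Ck_eq (IHk _ _ (Df v) (Dg v)) => z /set_mem qz.
have dfz := df z qz; have dgz := dg z qz.
by rewrite !deriveE ?diff_pair //; exact: differentiable_pair.
Qed.

Lemma differentiable_comp1 (V : normedModType R) (h : R -> R) (h' : R)
    (f : V -> R) (x : V) : is_derive (f x) 1 h h' -> differentiable f x ->
  differentiable (h \o f) x.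
Proof.
move=> [dh _] df; apply: differentiable_comp => //.
exact/derivable1_diffP.
Qed.

Lemma diff_comp1 (V : normedModType R) (h : R -> R) (h' : R)
    (f : V -> R) (x u : V) : is_derive (f x) 1 h h' -> differentiable f x ->
  'd (h \o f) x u = h' * 'd f x u.
Proof.
move=> [dh hE] df; have /derivable1_diffP dh1 := dh.
by rewrite diff_comp //= diff1E // derive1E hE mulrC.
Qed.

Lemma Ck_powR k (f : R * R -> R) (a : R) : (forall z, quadrant z -> 0 < f z) ->
  Ck_on_quadrant k f -> Ck_on_quadrant k (fun z => f z `^ a).
Proof.
move=> f0; elim: k a => [|k IHk] a Cf.
  move=> z qz; apply: (@continuous_comp _ _ _ f (@powR R ^~ a)); first exact: Cf.
  apply/differentiable_continuous/derivable1_diffP.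
  by have [] := is_derive1_powR a (f0 z qz).
have [df Df] := Cf; split=> [z qz|v].
  exact: differentiable_comp1 (is_derive1_powR a (f0 z qz)) (df z qz).
have := CkM (CkM (Ck_cst k a) (IHk (a - 1) (Ck_pred Cf))) (Df v).
apply: Ck_eq => z /set_mem qz; have fz := f0 z qz; have dfz := df z qz.
rewrite -[RHS]/('D_v (@powR R ^~ a \o f) z) !deriveE //.
  exact: (esym (diff_comp1 v (is_derive1_powR a fz) dfz)).
exact: differentiable_comp1 (is_derive1_powR a fz) _.
Qed.

(** The inverse is the power of exponent [-1], an identity used only where [f] is positive. *)
Lemma CkV k (f : R * R -> R) : (forall z, quadrant z -> 0 < f z) ->
  Ck_on_quadrant k f -> Ck_on_quadrant k (fun z => (f z)^-1).
Proof.
move=> f0 /(Ck_powR (-1) f0); apply: Ck_eq => z /set_mem qz.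
by rewrite powR_inv1 // ltW // f0.
Qed.


(** * Scaling of the logarithmic area form and its consequences *)

Definition area (u v : R * R) : R := u.1 * v.2 - v.1 * u.2.

(* [phi] multiplies the area form d log x /\ d log y by [c], with the
   denominators [x y] cleared. *)
Definition log_area_scaling (c : R) (phi : R * R -> R * R) :=
  forall z, quadrant z -> forall u v,
    z.1 * z.2 * area ('d phi z u) ('d phi z v) =
    c * ((phi z).1 * (phi z).2) * area u v.

Lemma log_area_scaling_comp c d (phi psi : R * R -> R * R) :
  smooth_self_map phi -> (forall z, quadrant z -> differentiable psi z) ->
  log_area_scaling c phi -> log_area_scaling d psi ->
  log_area_scaling (d * c) (psi \o phi).
Proof.
move=> [phiq /(_ 1%N)[dphi _]] dpsi Hphi Hpsi z qz u v.
have qpz := phiq z qz; have [p1 p2] := qpz.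
have dphiz := dphi z qz; have dpsiz := dpsi _ qpz.
rewrite diff_comp //=.
(* The factor is the product of the coordinates of the intermediate point [phi z], which the cleared
   form of the hypothesis on [psi] requires. It is nonzero because [phi] preserves the quadrant. *)
apply: (mulfI (lt0r_neq0 (mulr_gt0 p1 p2))).
rewrite mulrCA (Hpsi _ qpz) /=.
transitivity (d * ((psi (phi z)).1 * (psi (phi z)).2) *
  (z.1 * z.2 * area ('d phi z u) ('d phi z v))); first by ring.
by rewrite Hphi //; ring.
Qed.

Lemma diff_fst z u : 'd fst z u = u.1.
Proof. by rewrite diff_lin //; exact: continuous_fst. Qed.

Lemma diff_snd z u : 'd snd z u = u.2.
Proof. by rewrite diff_lin //; exact: continuous_snd. Qed.

Lemma differentiable_fst z : differentiable (fst : R * R -> R) z.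
Proof. by apply: linear_differentiable; exact: continuous_fst. Qed.

Lemma differentiable_snd z : differentiable (snd : R * R -> R) z.
Proof. by apply: linear_differentiable; exact: continuous_snd. Qed.

Lemma wedge_coordinates z u v : wedge (ext_d fst) (ext_d snd) z u v = area u v.
Proof.
by congr (_ * _ - _ * _);
  [exact: diff_fst | exact: diff_snd | exact: diff_fst | exact: diff_snd].
Qed.

(** By the chain rule [ln] contributes the factors [z.1^-1] and [z.2^-1], since both coordinates are
    positive. *)
Lemma omegaE z u v : quadrant z -> omega z u v = (z.1 * z.2)^-1 * area u v.
Proof.
move=> [z1 z2]; rewrite /omega /wedge /ext_d.
have d1 := is_derive1_ln z1; have d2 := is_derive1_ln z2.
have ln1 w : 'd (@ln R \o fst) z w = z.1^-1 * w.1.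
  by rewrite (diff_comp1 w d1 (differentiable_fst z)) diff_fst.
have ln2 w : 'd (@ln R \o snd) z w = z.2^-1 * w.2.
  by rewrite (diff_comp1 w d2 (differentiable_snd z)) diff_snd.
transitivity (z.1^-1 * u.1 * (z.2^-1 * v.2) - z.1^-1 * v.1 * (z.2^-1 * u.2)).
  by congr (_ * _ - _ * _); [exact: ln1 | exact: ln2 | exact: ln1 | exact: ln2].
by rewrite invfM /area; ring.
Qed.

Lemma preserves_omega (phi : R * R -> R * R) : smooth_self_map phi ->
  log_area_scaling 1 phi -> preserves_form phi (@omega R).
Proof.
move=> sphi H; split=> [|z qz u v]; first exact: sphi.
have [phiq _] := sphi.
have qp := phiq z qz; have [[z1 z2] [p1 p2]] := (qz, qp).
rewrite /pullback !omegaE //.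
have := H z qz u v; rewrite mul1r => Hz.
apply: (mulfI (lt0r_neq0 (mulr_gt0 z1 z2))).
rewrite mulrCA Hz mulKf ?mulVKf //; exact/lt0r_neq0/mulr_gt0.
Qed.

(** By the chain rule, the antisymmetric expression in the partial derivatives of [F \o phi] and
    [G \o phi] is the Jacobian determinant of [phi] times that of [F] and [G] at [phi z]. The
    scaling hypothesis turns [z.1 * z.2] times this determinant into the product of the coordinates
    of [phi z]. *)
Lemma poisson_log_area (phi : R * R -> R * R) : smooth_self_map phi ->
  log_area_scaling 1 phi -> poisson_map phi.
Proof.
move=> sphi H; split; first exact: sphi.
move=> F G sF sG z qz; have [phiq /(_ 1%N)[dphi _]] := sphi.
have qp := phiq z qz; have dphiz := dphi z qz.
have [/(_ _ qp) dF _] := sF 1%N; have [/(_ _ qp) dG _] := sG 1%N.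
have split_diff (h : R * R -> R) u : differentiable h (phi z) ->
    'd h (phi z) u = u.1 * 'D_(1, 0) h (phi z) + u.2 * 'D_(0, 1) h (phi z).
  move=> dh; rewrite !deriveE // -[u.1 * _]linearZ -[u.2 * _]linearZ -linearD.
  congr ('d h _ _); case: u => a b; apply: injective_projections => /=.
    by rewrite scaler0 addr0; exact/esym/mulr1.
  by rewrite scaler0 add0r; exact/esym/mulr1.
have chain (h : R * R -> R) v : differentiable h (phi z) ->
    'D_v (h \o phi) z = ('d phi z v).1 * 'D_(1, 0) h (phi z) +
                        ('d phi z v).2 * 'D_(0, 1) h (phi z).
  move=> dh; rewrite -(split_diff h ('d phi z v) dh).
  rewrite deriveE; last exact: differentiable_comp.
  exact: (congr1 (@^~ v) (diff_comp dphiz dh)).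
rewrite /bracket (chain F _ dF) (chain F _ dF) (chain G _ dG) (chain G _ dG).
(* On the standard basis, the area of the image vectors is the Jacobian determinant. *)
have := H z qz (1, 0) (0, 1); rewrite /area /= mul1r mulr1 mulr0 subr0 mulr1.
move=> <-; move: ('D_(1, 0) F _) ('D_(0, 1) F _) ('D_(1, 0) G _) ('D_(0, 1) G _).
by move=> Fx Fy Gx Gy; ring.
Qed.

(** * Positivity and smoothness of the exchange maps *)

Lemma mu1_quadrant q z : quadrant z -> quadrant (mu1 q z).
Proof. by move=> [z1 z2]; split=> //=; rewrite divr_gt0 // addr_gt0 // powR_gt0. Qed.

Lemma mu2_quadrant p z : quadrant z -> quadrant (mu2 p z).
Proof. by move=> [z1 z2]; split=> //=; rewrite divr_gt0 // addr_gt0 // powR_gt0. Qed.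

Lemma smooth_fst : smooth_on_quadrant (fst : R * R -> R).
Proof. by move=> k; apply: Ck_linear; exact: continuous_fst. Qed.

Lemma smooth_snd : smooth_on_quadrant (snd : R * R -> R).
Proof. by move=> k; apply: Ck_linear; exact: continuous_snd. Qed.

(** Keeping [f] and [g] general covers the nontrivial component of [mu1] and [mu2], and also the
    second component of [mu], where [f] is the first component of [mu1]. Smoothness of [mu] then
    needs no composition rule. *)
Lemma smooth_exchange (a : R) (f g : R * R -> R) :
  (forall z, quadrant z -> 0 < f z) -> (forall z, quadrant z -> 0 < g z) ->
  smooth_on_quadrant f -> smooth_on_quadrant g ->
  smooth_on_quadrant (fun z => (1 + f z `^ a) / g z).
Proof.
move=> f0 g0 sf sg k; apply: CkM; last exact: CkV.
by apply: CkD; [exact: Ck_cst | exact: Ck_powR].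
Qed.

Lemma smooth_mu1 q : smooth_on_quadrant (mu1 q).
Proof.
move=> k; apply: Ck_pair; last exact: smooth_snd.
by apply: smooth_exchange => [z []|z []||] //; [exact: smooth_snd|exact: smooth_fst].
Qed.

Lemma smooth_mu2 p : smooth_on_quadrant (mu2 p).
Proof.
move=> k; apply: Ck_pair; first exact: smooth_fst.
by apply: smooth_exchange => [z []|z []||] //; [exact: smooth_fst|exact: smooth_snd].
Qed.

Lemma smooth_mu p q : smooth_on_quadrant (mu p q).
Proof.
have smu1 : smooth_on_quadrant (fun z => (mu1 q z).1).
  by apply: smooth_exchange => [z []|z []||] //; [exact: smooth_snd|exact: smooth_fst].
move=> k; apply: Ck_pair => //.
apply: smooth_exchange => [z /(mu1_quadrant q)[]|z []||] //.
exact: smooth_snd.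
Qed.

(** * Differentials of the exchange maps and their effect on area *)

Lemma diff_exchange (a : R) (f g : R * R -> R) z u : 0 < f z -> 0 < g z ->
  differentiable f z -> differentiable g z ->
  'd (fun z => (1 + f z `^ a) / g z) z u =
    a * f z `^ (a - 1) * 'd f z u / g z
    - (1 + f z `^ a) / g z ^+ 2 * 'd g z u.
Proof.
move=> f0 g0 df dg; have dpow := is_derive1_powR a f0.
have dfa : differentiable (@powR R ^~ a \o f) z by exact: differentiable_comp1 df.
have gn0 : g z != 0 by rewrite gt_eqF.
have dgV : differentiable (fun z => (g z)^-1) z by exact: differentiableV.
(* The numerator is spelled as a sum of functions so that the sum and product rules for
   differentials apply up to conversion. *)
have dnum : differentiable (cst 1 + (@powR R ^~ a \o f)) z by exact: differentiableD.
have num_u : 'd (cst 1 + (@powR R ^~ a \o f)) z u = a * f z `^ (a - 1) * 'd f z u.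
  rewrite -(diff_comp1 u dpow df).
  apply: etrans (congr1 (@^~ u) (diffD (differentiable_cst (1 : R) z) dfa)) _.
  apply: etrans (congr1 (+%R^~ _) (congr1 (@^~ u) (diff_cst (1 : R) z))) _.
  exact: add0r.
have inv_u := congr1 (@^~ u) (diffV dg gn0).
rewrite [LHS](congr1 (@^~ u) (diffM dnum dgV)) /=.
transitivity ((1 + f z `^ a) * (- (g z) ^- 2 * 'd g z u) +
              (g z)^-1 * (a * f z `^ (a - 1) * 'd f z u)).
  by congr (_ * _ + _ * _); [exact: inv_u | exact: num_u].
by move: ('d f z u) ('d g z u) (f z `^ a) (f z `^ (a - 1)) (g z) gn0 => *; field.
Qed.

(** The Jacobian matrix is triangular, so the derivative of [z.2]^
    q[drops out and the determinant is]- (1 + z.2 [^ q) / z.1 ^+ 2]. Multiplied by [z.1 * z.2], this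
    is minus the product of the coordinates of [mu1 q z]. *)
Lemma log_area_scaling_mu1 q : log_area_scaling (-1) (mu1 q).
Proof.
move=> z qz u v; have [z1 z2] := qz.
have [d1 d2] := (differentiable_fst z, differentiable_snd z).
have [ds _] := smooth_exchange q (fun z (qz : quadrant z) => proj2 qz)
  (fun z (qz : quadrant z) => proj1 qz) smooth_snd smooth_fst 1%N.
have dsz := ds z qz.
have dmu1 w : 'd (mu1 q) z w =
    (q * z.2 `^ (q - 1) * w.2 / z.1 - (1 + z.2 `^ q) / z.1 ^+ 2 * w.1, w.2).
  apply: etrans (congr1 (@^~ w) (diff_pair dsz d2)) _; congr pair.
    by rewrite -(diff_fst z w) -(diff_snd z w); exact: diff_exchange.
  exact: diff_snd.
rewrite (dmu1 u) (dmu1 v) /area /=.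
by field; exact: lt0r_neq0.
Qed.

Lemma log_area_scaling_mu2 p : log_area_scaling (-1) (mu2 p).
Proof.
move=> z qz u v; have [z1 z2] := qz.
have [d1 d2] := (differentiable_fst z, differentiable_snd z).
have [ds _] := smooth_exchange p (fun z (qz : quadrant z) => proj1 qz)
  (fun z (qz : quadrant z) => proj2 qz) smooth_fst smooth_snd 1%N.
have dsz := ds z qz.
have dmu2 w : 'd (mu2 p) z w =
    (w.1, p * z.1 `^ (p - 1) * w.1 / z.2 - (1 + z.1 `^ p) / z.2 ^+ 2 * w.2).
  apply: etrans (congr1 (@^~ w) (diff_pair d1 dsz)) _; congr pair.
    exact: diff_fst.
  by rewrite -(diff_fst z w) -(diff_snd z w); exact: diff_exchange.
rewrite (dmu2 u) (dmu2 v) /area /=.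
by field; exact: lt0r_neq0.
Qed.

End quadrant_calculus.

Theorem proposition2p1 (R : realType) (p q : R) (p_gt0 : 0 < p) (q_gt0 : 0 < q) :
  (forall z : R * R, quadrant z -> forall u v : R * R,
     omega z u v = (z.1 * z.2)^-1 * wedge (ext_d fst) (ext_d snd) z u v) /\
  preserves_form (mu p q) (@omega R) /\
  poisson_map (mu p q).
Proof.
have smu : smooth_self_map (mu p q).
  by split=> [z qz|]; [exact/mu2_quadrant/mu1_quadrant | exact: smooth_mu].
have scale1 : log_area_scaling 1 (mu p q).
  have smu1 : smooth_self_map (mu1 q).
    by split=> [z|]; [exact: mu1_quadrant | exact: smooth_mu1].
  have [dmu2 _] := smooth_mu2 p 1%N.
  (* The two sign reversals cancel. *)
  have := log_area_scaling_comp smu1 dmu2 (log_area_scaling_mu1 q)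
    (log_area_scaling_mu2 p).
  by rewrite mulrNN mulr1.
split; last by split; [exact: preserves_omega | exact: poisson_log_area].
by move=> z qz u v; rewrite omegaE // wedge_coordinates.
Qed.
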